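(* Assume $w_{xy}\le1$ for all $x,y\in\mathcal{X}$ and that the graph is connected. Let $u_*:\mathcal{X}\to\mathbb{R}$ be the solution of \[-\mathscr{L}^G_pu_*(x)=0\ \text{ if }x\in\mathcal{X}\setminus\mathcal{O},\qquad u_*(x)=g(x)\ \text{ if }x\in\mathcal{O},\] and define $u^k(x)=\tfrac12(\overline u^k(x)+\underline u^k(x))$. If $\alpha\le p/(2p-3)$ then for all $k\ge1$ and all $x\in\mathcal{X}$ we have \[|u^k(x)-u_*(x)|\le\frac12|\overline u^k(x)-\underline u^k(x)|\] and \[\lim_{k\to\infty}\overline u^k(x)=\lim_{k\to\infty}\underline u^k(x)=u_*(x).\]
   Context: $G=(\mathcal{X},\mathcal{W})$ is a finite undirected weighted graph with vertex set $\mathcal{X}$ and symmetric nonnegative weights $w_{xy}$; connected means connected via edges with $w_{xy}>0$. $\mathcal{O}\subset\mathcal{X}$ is a nonempty set of labeled vertices and $g:\mathcal{O}\to\mathbb{R}$. $d_x=\sum_{y\in\mathcal{X}}w_{xy}>0$. For $2\le p\le\infty$ the game-theoretic graph $p$-Laplacian is \[\mathscr{L}^G_pu(x)=\frac{1}{d_xp}\sum_{y\in\mathcal{X}}w_{xy}(u(y)-u(x))+\left(1-\tfrac2p\right)\left(\min_{y\in\mathcal{X}}w_{xy}(u(y)-u(x))+\max_{y\in\mathcal{X}}w_{xy}(u(y)-u(x))\right)\] (if $p=\infty$, $1/p=0$ and $p/(2p-3)$ means $1/2$). Under the connectedness assumption the solution $u_*$ exists and is unique. $\alpha>0$ is a time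 step. Define $\overline u^0(x)=\max_{\mathcal{O}}g$ and $\underline u^0(x)=\min_{\mathcal{O}}g$ for $x\in\mathcal{X}\setminus\mathcal{O}$, and $\overline u^0=\underline u^0=g$ on $\mathcal{O}$. For $k\ge0$ define \[\overline u^{k+1}(x)=\overline u^k(x)+\alpha\mathscr{L}^G_p\overline u^k(x),\qquad\underline u^{k+1}(x)=\underline u^k(x)+\alpha\mathscr{L}^G_p\underline u^k(x)\] for $x\in\mathcal{X}\setminus\mathcal{O}$, and $\overline u^{k+1}(x)=\underline u^{k+1}(x)=g(x)$ for $x\in\mathcal{O}$. *)

(* Defs.v *)
From HB Require Import structures.
From mathcomp Require Import all_boot all_order all_algebra.
From mathcomp Require Import all_classical all_reals all_analysis.

Set Implicit Arguments.
Unset Strict Implicit.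
Unset Printing Implicit Defensive.

Import Order.TTheory GRing.Theory Num.Theory.
Import numFieldNormedType.Exports.

Local Open Scope ring_scope.

(* Maximum and minimum of [f] over a finite set [A], with junk value 0 when [A]
   is empty. *)
Definition set_max (R : realType) (X : finType) (A : {set X}) (f : X -> R) : R :=
  if [pick x in A] is Some x0 then f [arg max_(x > x0 in A) f x]%O else 0.

Definition set_min (R : realType) (X : finType) (A : {set X}) (f : X -> R) : R :=
  if [pick x in A] is Some x0 then f [arg min_(x < x0 in A) f x]%O else 0.

Definition wgraph_connected (R : realType) (X : finType) (w : X -> X -> R) : Prop :=
  forall x y : X, connect (fun a b => 0 < w a b) x y.

Definition wdegree (R : realType) (X : finType) (w : X -> X -> R) (x : X) : R :=
  \sum_(y : X) w x y.

(* [1 / p] for an extended real exponent; [+oo^-1 = 0] in [\bar R]. *)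
Definition exponent_inv (R : realType) (p : \bar R) : R := fine (p^-1)%E.

(* [p / (2 p - 3)], read as its limit [1 / 2] at [p = +oo]. *)
Definition max_time_step (R : realType) (p : \bar R) : R :=
  if p is r%:E then r / (2 * r - 3) else 2^-1.

(* Both extrema range over all vertices, [y = x] and non-neighbours included. *)
Definition game_p_laplacian (R : realType) (X : finType) (w : X -> X -> R)
    (p : \bar R) (u : X -> R) (x : X) : R :=
  (wdegree w x)^-1 * exponent_inv p * (\sum_(y : X) w x y * (u y - u x)) +
  (1 - 2 * exponent_inv p) *
    (set_min [set: X] (fun y => w x y * (u y - u x)) +
     set_max [set: X] (fun y => w x y * (u y - u x))).

(* Boundary data are total functions on [X]; only the values of [g] on [O] are
   ever used, here and below. *)
Definition is_solution (R : realType) (X : finType) (w : X -> X -> R)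
    (p : \bar R) (O : {set X}) (g : X -> R) (u : X -> R) : Prop :=
  (forall x, x \notin O -> - game_p_laplacian w p u x = 0) /\
  (forall x, x \in O -> u x = g x).

Definition euler_step (R : realType) (X : finType) (w : X -> X -> R)
    (p : \bar R) (O : {set X}) (g : X -> R) (alpha : R) (u : X -> R) : X -> R :=
  fun x => if x \in O then g x else u x + alpha * game_p_laplacian w p u x.

Definition upper_iter (R : realType) (X : finType) (w : X -> X -> R)
    (p : \bar R) (O : {set X}) (g : X -> R) (alpha : R) (k : nat) : X -> R :=
  iter k (euler_step w p O g alpha)
    (fun x => if x \in O then g x else set_max O g).

Definition lower_iter (R : realType) (X : finType) (w : X -> X -> R)
    (p : \bar R) (O : {set X}) (g : X -> R) (alpha : R) (k : nat) : X -> R :=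
  iter k (euler_step w p O g alpha)
    (fun x => if x \in O then g x else set_min O g).

Definition mid_iter (R : realType) (X : finType) (w : X -> X -> R)
    (p : \bar R) (O : {set X}) (g : X -> R) (alpha : R) (k : nat) : X -> R :=
  fun x => 2^-1 * (upper_iter w p O g alpha k x + lower_iter w p O g alpha k x).

(* Main.v *)
(* Write [q = 1/p]. Since the weights are at most 1, raising [u x] by [c]
   lowers [L u x] by at most [(2 - 3 q) c]; hence for [alpha (2 - 3 q) <= 1],
   which is the bound [alpha <= p / (2p - 3)], the Euler step [E] is monotone,
   and as it commutes with adding constants off [O] it is nonexpansive in the
   sup norm. The constants [max g] and [min g] are super- and subsolutions, so
   the upper iterates decrease, the lower ones increase, and they sandwich the
   fixed point [ustar]. Their limits are again fixed points of [E], that is,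
   solutions, and these are unique by a strong maximum principle, which for
   [p = +oo] needs a separate argument. *)

Require Import Defs.
From HB Require Import structures.
From mathcomp Require Import all_boot all_order all_algebra.
From mathcomp Require Import all_classical all_reals all_analysis.
From mathcomp Require Import ring lra.

Set Implicit Arguments.
Unset Strict Implicit.
Unset Printing Implicit Defensive.

Import Order.TTheory GRing.Theory Num.Theory.
Import numFieldNormedType.Exports.

Local Open Scope classical_set_scope.
Local Open Scope ring_scope.

(** * Extrema over nonempty finite sets *)

Section SetExtrema.
Variables (R : realType) (X : finType).
Implicit Types (A : {set X}) (f h : X -> R) (x y : X).

Lemma set_max_ge A f x : x \in A -> f x <= set_max A f.
Proof.
rewrite /set_max; case: pickP => [x0 x0A xA|/(_ x) /= -> //].
by case: arg_maxP => // i _; apply.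
Qed.

Lemma set_min_le A f x : x \in A -> set_min A f <= f x.
Proof.
rewrite /set_min; case: pickP => [x0 x0A xA|/(_ x) /= -> //].
by case: arg_minP => // i _; apply.
Qed.

Lemma set_max_attained A f x : x \in A ->
  exists2 y, y \in A & set_max A f = f y.
Proof.
rewrite /set_max; case: pickP => [x0 x0A xA|/(_ x) /= -> //].
by case: arg_maxP => // i iA _; exists i.
Qed.

Lemma set_min_attained A f x : x \in A ->
  exists2 y, y \in A & set_min A f = f y.
Proof.
rewrite /set_min; case: pickP => [x0 x0A xA|/(_ x) /= -> //].
by case: arg_minP => // i iA _; exists i.
Qed.

Lemma set_max_leD A f h c x : x \in A ->
  (forall y, y \in A -> f y <= h y + c) ->
  set_max A f <= set_max A h + c.
Proof.
move=> xA fh; have [y yA ->] := set_max_attained f xA.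
by rewrite (le_trans (fh y yA))// lerD2r set_max_ge.
Qed.

Lemma set_min_leD A f h c x : x \in A ->
  (forall y, y \in A -> f y <= h y + c) ->
  set_min A f <= set_min A h + c.
Proof.
move=> xA fh; have [y yA ->] := set_min_attained h xA.
by rewrite (le_trans _ (fh y yA))// set_min_le.
Qed.

End SetExtrema.

(** * Exponent, time step and connectedness *)

Lemma exponent_inv_ge0 (R : realType) (p : \bar R) :
  (2%:E <= p)%E -> 0 <= exponent_inv p.
Proof.
rewrite /exponent_inv; case: p => [r| |]; rewrite ?leeNy_eq//= lee_fin => r2.
by rewrite inver gt_eqF ?(lt_le_trans _ r2)//= invr_ge0 (le_trans _ r2).
Qed.

Lemma exponent_inv_le_half (R : realType) (p : \bar R) :
  (2%:E <= p)%E -> 2 * exponent_inv p <= 1.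
Proof.
rewrite /exponent_inv; case: p => [r| |]; rewrite ?leeNy_eq ?mulr0//=.
rewrite lee_fin => r2.
have r0 : 0 < r by rewrite (lt_le_trans _ r2).
by rewrite inver gt_eqF//= ler_pdivrMr// mul1r.
Qed.

Lemma max_time_stepM (R : realType) (p : \bar R) :
  (2%:E <= p)%E -> max_time_step p * (2 - 3 * exponent_inv p) = 1.
Proof.
rewrite /exponent_inv /max_time_step; case: p => [r| |] //=.
  rewrite lee_fin => r2.
  have r0 : 0 < r by rewrite (lt_le_trans _ r2).
  rewrite inver gt_eqF//=; field.
  by apply/andP; split; rewrite gt_eqF//; lra.
by rewrite mulr0 subr0 mulVf// pnatr_eq0.
Qed.

(** Induction along a path. In [comparison] it carries a set of maximum points to a vertex of [O],
    where such a set cannot reach. *)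
Lemma wgraph_connected_closed (R : realType) (X : finType) (w : X -> X -> R)
    (B : {pred X}) (x y : X) : wgraph_connected w ->
  (forall a b, a \in B -> 0 < w a b -> b \in B) -> x \in B -> y \in B.
Proof.
move=> /(_ x y) /connectP [s sp ->] Bcl; elim: s x sp => //= z s IH x.
by move=> /andP[wxz zs] xB; apply: IH zs (Bcl _ _ xB wxz).
Qed.

(** * Order properties and comparison principle of the game Laplacian *)

Section GameLaplacian.
Variables (R : realType) (X : finType) (w : X -> X -> R) (O : {set X}).
Variables (p : \bar R).
Hypothesis w_ge0 : forall x y : X, 0 <= w x y.
Hypothesis deg_gt0 : forall x : X, 0 < wdegree w x.
Hypothesis p_ge2 : (2%:E <= p)%E.
Implicit Types (u v g : X -> R) (x y : X).

Local Notation incr f x := (fun y => w x y * (f y - f x)).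
Local Notation V := [set: X]%SET.
Local Notation q := (exponent_inv p).
Local Notation L := (game_p_laplacian w p).

(** The averaging term adds [q * c], as the weights at [x] sum to the degree; the minimum and the
    maximum add at most [c] each because weights are at most 1. In total
    [q + 2 * (1 - 2 * q) = 2 - 3 * q]. *)
Lemma game_p_laplacian_leD u v c x : (forall y, w x y <= 1) -> 0 <= c ->
  (forall y, u y - u x <= v y - v x + c) ->
  L u x <= L v x + (2 - 3 * q) * c.
Proof.
move=> w_le1 c0 uv.
have wuv y : w x y * (u y - u x) <= w x y * (v y - v x) + w x y * c.
  by rewrite -mulrDr ler_wpM2l.
have wuv1 y : y \in V -> w x y * (u y - u x) <= w x y * (v y - v x) + c.
  by move=> _; rewrite (le_trans (wuv y))// lerD2l ler_piMl.
have Hmax := set_max_leD (finset.in_setT x) wuv1.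
have Hmin := set_min_leD (finset.in_setT x) wuv1.
have Hsum : \sum_y w x y * (u y - u x) <=
    \sum_y w x y * (v y - v x) + wdegree w x * c.
  by rewrite /wdegree mulr_suml -big_split/=; exact: ler_sum.
have q0 := exponent_inv_ge0 p_ge2.
have q1 := exponent_inv_le_half p_ge2.
have d0 : 0 <= (wdegree w x)^-1 * q by rewrite mulr_ge0// invr_ge0 ltW.
have c2 : 0 <= 1 - 2 * q by rewrite subr_ge0.
have := ler_wpM2l c2 (lerD Hmin Hmax).
have := ler_wpM2l d0 Hsum.
have -> : (wdegree w x)^-1 * q * (\sum_y w x y * (v y - v x) + wdegree w x * c)
   = (wdegree w x)^-1 * q * (\sum_y w x y * (v y - v x)) + q * c.
  by field; rewrite gt_eqF.
rewrite /game_p_laplacian; lra.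
Qed.

Lemma game_p_laplacian_addr u c x : L (fun y => u y + c) x = L u x.
Proof.
rewrite /game_p_laplacian.
have E y : u y + c - (u x + c) = u y - u x by ring.
under eq_bigr do rewrite E.
by have -> : (fun y => w x y * (u y + c - (u x + c))) =
    incr u x by apply/funext => y; rewrite E.
Qed.

Lemma game_p_laplacian_cst c x : L (fun=> c) x = 0.
Proof.
rewrite /game_p_laplacian; under eq_bigr do rewrite subrr mulr0.
rewrite big1_eq mulr0 add0r; set f := fun _ => _.
have [y _ ->] := set_max_attained f (finset.in_setT x).
have [z _ ->] := set_min_attained f (finset.in_setT x).
by rewrite /f subrr !mulr0 addr0 mulr0.
Qed.

(* The first hypothesis holds at every maximum point of [u - v]. *)
Lemma game_p_laplacian_touching u v x :
  (forall y, u y - u x <= v y - v x) -> L u x = L v x ->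
  (0 < q -> forall y, 0 < w x y -> u y - u x = v y - v x) /\
  (q = 0 -> set_max V (incr u x) = set_max V (incr v x)).
Proof.
move=> uv.
have wuv y : w x y * (u y - u x) <= w x y * (v y - v x) by rewrite ler_wpM2l.
have wuv0 y : y \in V -> w x y * (u y - u x) <= w x y * (v y - v x) + 0.
  by rewrite addr0.
have Hmax := set_max_leD (finset.in_setT x) wuv0.
have Hmin := set_min_leD (finset.in_setT x) wuv0.
rewrite !addr0 in Hmax Hmin.
have q1 := exponent_inv_le_half p_ge2.
have c2 : 0 <= 1 - 2 * q by rewrite subr_ge0.
rewrite /game_p_laplacian => Luv; split=> [q0 y wxy|q0]; last first.
  (* At [q = 0] only minimum plus maximum remains; both are ordered, so equal totals force equal
     maxima. *)
  by move: Luv; rewrite q0; lra.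
have Hsum : \sum_z w x z * (u z - u x) <= \sum_z w x z * (v z - v x).
  exact: ler_sum.
have d0 : 0 < (wdegree w x)^-1 * q by rewrite mulr_gt0// invr_gt0.
have := ler_wpM2l c2 (lerD Hmin Hmax).
have := ler_wpM2l (ltW d0) Hsum => H1 H2.
(* Both parts of [L] are ordered the same way, so equality of [L] leaves no slack in the averaging
   part. *)
have {H1 H2} /(mulfI (lt0r_neq0 d0)) Esum :
    (wdegree w x)^-1 * q * (\sum_z w x z * (u z - u x)) =
    (wdegree w x)^-1 * q * (\sum_z w x z * (v z - v x)) by lra.
have /leifP : \sum_z w x z * (u z - u x) <= \sum_z w x z * (v z - v x)
    ?= iff [forall z, w x z * (u z - u x) == w x z * (v z - v x)].
  by apply: leif_sum => z _; split.
case: ifPn => [/forallP/(_ y)/eqP/(mulfI (lt0r_neq0 wxy))//|_].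
by rewrite Esum ltxx.
Qed.

(* For [q = 0] closedness under neighbours can fail on the whole set where
   [u - v] is maximal; it holds on its subset where [u] is largest. *)
Lemma comparison u v : wgraph_connected w -> O != finset.set0 ->
  (forall x, x \notin O -> L u x = 0) -> (forall x, x \notin O -> L v x = 0) ->
  (forall x, x \in O -> u x <= v x) -> forall x, u x <= v x.
Proof.
move=> w_conn /finset.set0Pn [z zO] Lu Lv uvO x1.
have [x0 _ x0max] := @arg_maxP _ R X x1 xpredT (fun x => u x - v x) isT.
suff : u x0 <= v x0 by move=> uv0; have /= := x0max x1 isT; lra.
rewrite leNgt; apply/negP => x0gt.
pose A := [pred x | u x - v x == u x0 - v x0].
have AO x : x \in A -> x \notin O.
  by rewrite inE => /eqP xA; apply/negP => /uvO; lra.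
have Ainc x : x \in A -> forall y, u y - u x <= v y - v x.
  by rewrite inE => /eqP xA y; have /= := x0max y isT; lra.
have LA x : x \in A -> L u x = L v x by move=> /AO xO; rewrite Lu// Lv.
have touch x (xA : x \in A) := game_p_laplacian_touching (Ainc x xA) (LA x xA).
have x0A : x0 \in A by rewrite inE.
have := exponent_inv_ge0 p_ge2; rewrite le_eqVlt.
case/orP => [/eqP q0|q0]; last first.
  suff /AO : z \in A by rewrite zO.
  (* For [0 < q] the increments of [u] and [v] along each edge at [a] agree, so [u - v] is as large
     at [b] as at [a]. *)
  apply: wgraph_connected_closed w_conn _ x0A => a b aA wab.
  have [/(_ q0 b wab) E _] := touch a aA.
  by move: aA; rewrite !inE => /eqP aA; apply/eqP; lra.
have [b0 b0A b0max] := @arg_maxP _ R X x0 (mem A) u x0A.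
pose B := [pred x | (x \in A) && (u x == u b0)].
suff : z \in B by rewrite inE => /andP[/AO]; rewrite zO.
have b0B : b0 \in B by apply/andP; split.
apply: wgraph_connected_closed w_conn _ b0B => a b /andP[aA /eqP ua] wab.
have [_ /(_ (esym q0)) Emax] := touch a aA.
have Lmax f : L f a = 0 -> set_min V (incr f a) = - set_max V (incr f a).
  by rewrite /game_p_laplacian -q0; lra.
(* Were the maximum positive, attained at [y], equality of the two maxima would make [v] rise no
   more than [u] from [a] to [y]. Then [y] lies in [A] with [u y > u a], against the choice of
   [b0]. *)
have Su : set_max V (incr u a) <= 0.
  have [y _ Ey] := set_max_attained (incr u a) (finset.in_setT a).
  rewrite leNgt; apply/negP => S0; rewrite Ey in S0.
  have wy : 0 < w a y.
    by rewrite lt0r w_ge0 andbT; apply: contraTneq S0 => ->; rewrite mul0r ltxx.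
  have uy : 0 < u y - u a by rewrite -(pmulr_rgt0 _ wy).
  have : w a y * (v y - v a) <= w a y * (u y - u a).
    by rewrite -Ey Emax (set_max_ge (incr v a)) ?finset.in_setT.
  rewrite ler_pM2l// => vy.
  have yA : y \in A.
    move: aA; rewrite !inE => /eqP aA; apply/eqP.
    by have /= := x0max y isT; lra.
  by have /= := b0max y yA; lra.
(* A maximum [<= 0] with the opposite minimum squeezes all weighted increments to 0. *)
have flat f : set_max V (incr f a) <= 0 ->
    set_min V (incr f a) = - set_max V (incr f a) -> f b = f a.
  move=> M0 mM; apply/eqP; rewrite -subr_eq0 eq_le -(pmulr_rle0 _ wab).
  rewrite -(pmulr_rge0 _ wab).
  rewrite (le_trans (set_max_ge (incr f a) (finset.in_setT b)))//=.
  apply: le_trans (set_min_le (incr f a) (finset.in_setT b)).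
  by rewrite mM oppr_ge0.
have ub := flat u Su (Lmax u (Lu a (AO a aA))).
have vb : v b = v a.
  by apply: flat; [rewrite -Emax|exact: Lmax (Lv a (AO a aA))].
by rewrite inE/= ub ua eqxx andbT; move: aA; rewrite !inE ub vb.
Qed.

(** * Monotonicity and fixed points of the Euler step *)

Section EulerStep.
Variables (g : X -> R) (alpha : R).
Hypothesis w_le1 : forall x y : X, w x y <= 1.
Hypothesis alpha_gt0 : 0 < alpha.
Hypothesis alpha_le : alpha <= max_time_step p.

Local Notation E := (euler_step w p O g alpha).

Lemma euler_step_mono u v : (forall x, u x <= v x) -> forall x, E u x <= E v x.
Proof.
move=> uv x; rewrite /euler_step; case: ifP => // _.
have c0 : 0 <= v x - u x by rewrite subr_ge0.
(* The constant is the gap at [x] itself: the term [u x] of the step is smaller than [v x] by this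
   gap, which pays for the loss in [L]. *)
have H y : u y - u x <= v y - v x + (v x - u x) by have := uv y; lra.
have K0 : 0 <= 2 - 3 * q by have := exponent_inv_le_half p_ge2; lra.
have K1 : alpha * (2 - 3 * q) <= 1.
  by rewrite -[leRHS](max_time_stepM p_ge2) ler_wpM2r.
have := ler_wpM2l (ltW alpha_gt0) (game_p_laplacian_leD (w_le1 x) c0 H).
have := ler_wpM2r c0 K1.
lra.
Qed.

Lemma euler_step_nonexpansive u v c : 0 <= c ->
  (forall x, `|u x - v x| <= c) -> forall x, `|E u x - E v x| <= c.
Proof.
move=> c0 uvc x.
(* Monotonicity against [u2 + c]: off [O] the constant passes through the step, on [O] both values
   are [g x] and [0 <= c] suffices. *)
have half u1 u2 : (forall x, u1 x <= u2 x + c) -> E u1 x <= E u2 x + c.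
  move=> u12; apply: le_trans (euler_step_mono u12 x) _.
  rewrite /euler_step; case: ifP => _; first by rewrite lerDl.
  by rewrite game_p_laplacian_addr; lra.
rewrite ler_distl lerBlDr !half// => y; have := uvc y; rewrite ler_distl; lra.
Qed.

Lemma euler_step_fixed u : is_solution w p O g u -> E u = u.
Proof.
case=> Lu uO; apply/funext => x; rewrite /euler_step.
case: ifPn => [/uO->//|/Lu/eqP]; rewrite oppr_eq0 => /eqP ->.
by rewrite mulr0 addr0.
Qed.

Lemma fixed_euler_step u : E u = u -> is_solution w p O g u.
Proof.
move=> Eu; split=> x xO; have := congr1 (@^~ x) Eu; rewrite /euler_step/=.
  move: xO => /negbTE -> /eqP; rewrite -subr_eq0 addrAC subrr add0r.
  by rewrite mulf_eq0 gt_eqF//= => /eqP ->; rewrite oppr0.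
by rewrite xO.
Qed.

(** The shifted iterates tend to [E u] by nonexpansiveness and to [u] because a shift keeps the
    limit. *)
Lemma iter_euler_step_lim u0 u :
  (forall x, iter k E u0 x @[k --> \oo] --> u x) -> is_solution w p O g u.
Proof.
move=> cvu; apply: fixed_euler_step; apply/funext => x.
apply: (@cvg_unique _ (@Rhausdorff R) (iter k.+1 E u0 x @[k --> \oo])).
- apply/cvgrPdist_le => e e0.
  have : \forall k \near \oo, forall y, `|u y - iter k E u0 y| <= e.
    (* Pointwise convergence is uniform since [X] is finite. *)
    by apply: filter_forall => y; move: (cvu y) => /cvgrPdist_le; apply.
  by apply: filterS => k /(euler_step_nonexpansive (ltW e0)); apply.
- by have := cvu x; rewrite -(cvg_shiftS (fun k => iter k E u0 x)).
Qed.

(** * Iterates compared with solutions and with each other *)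

Lemma iter_euler_step_mono u v k : (forall x, u x <= v x) ->
  forall x, iter k E u x <= iter k E v x.
Proof. by move=> uv; elim: k => //= k IH; exact: euler_step_mono. Qed.

Lemma iter_euler_step_solution u k : is_solution w p O g u -> iter k E u = u.
Proof. by move=> us; elim: k => //= k ->; exact: euler_step_fixed. Qed.

Lemma solution_laplacian_eq0 u x :
  is_solution w p O g u -> x \notin O -> L u x = 0.
Proof. by case=> Lu _ /Lu/eqP; rewrite oppr_eq0 => /eqP. Qed.

Lemma solution_unique u v : wgraph_connected w -> O != finset.set0 ->
  is_solution w p O g u -> is_solution w p O g v -> u = v.
Proof.
move=> w_conn On us vs; apply/funext => x; apply/eqP.
have Lu := solution_laplacian_eq0 us; have Lv := solution_laplacian_eq0 vs.
case: us vs => _ uO [_ vO].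
by rewrite eq_le !comparison// => y yO; rewrite uO// vO.
Qed.

(** Every iterate fixes the solution, so monotonicity reduces the claim to [k = 0], which is
    comparison with a constant. *)
Lemma upper_iter_ge u k x : wgraph_connected w -> O != finset.set0 ->
  is_solution w p O g u -> u x <= upper_iter w p O g alpha k x.
Proof.
move=> w_conn On us; rewrite -[u in u x](iter_euler_step_solution k us).
apply: iter_euler_step_mono => {x} x.
have Lu := solution_laplacian_eq0 us; case: us => _ uO.
case: ifPn => [/uO->//|_].
apply: (comparison (v := fun=> set_max O g) w_conn On) => [y|y _|y yO].
- exact: Lu.
- exact: game_p_laplacian_cst.
- by rewrite uO// set_max_ge.
Qed.

Lemma lower_iter_le u k x : wgraph_connected w -> O != finset.set0 ->
  is_solution w p O g u -> lower_iter w p O g alpha k x <= u x.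
Proof.
move=> w_conn On us; rewrite -[u in _ <= u x](iter_euler_step_solution k us).
apply: iter_euler_step_mono => {x} x.
have Lu := solution_laplacian_eq0 us; case: us => _ uO.
case: ifPn => [/uO->//|_].
apply: (comparison (u := fun=> set_min O g) w_conn On) => [y _|y|y yO].
- exact: game_p_laplacian_cst.
- exact: Lu.
- by rewrite uO// set_min_le.
Qed.

(** By monotonicity only the first step matters. Off [O] the starting function is at its largest
    value, so its increments lie below those of a constant and [L] is at most 0 there. *)
Lemma upper_iter_nonincreasing x :
  nonincreasing_seq (fun k => upper_iter w p O g alpha k x).
Proof.
apply/nonincreasing_seqP => k; rewrite /upper_iter iterSr.
apply: iter_euler_step_mono => {x} x; rewrite /euler_step/=.
case: ifPn => // xO; rewrite (negbTE xO) gerDl pmulr_rle0//.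
have -> : 0 = L (fun=> set_max O g) x + (2 - 3 * q) * 0.
  by rewrite game_p_laplacian_cst mulr0 addr0.
apply: game_p_laplacian_leD => // y; rewrite (negbTE xO) addr0 lerD2r.
by case: ifPn => // yO; rewrite set_max_ge.
Qed.

Lemma lower_iter_nondecreasing x :
  nondecreasing_seq (fun k => lower_iter w p O g alpha k x).
Proof.
apply/nondecreasing_seqP => k; rewrite /lower_iter iterSr.
apply: iter_euler_step_mono => {x} x; rewrite /euler_step/=.
case: ifPn => // xO; rewrite lerDl pmulr_rge0//.
rewrite -(game_p_laplacian_cst (set_min O g) x) -[leRHS]addr0.
rewrite -[X in _ + X](mulr0 (2 - 3 * q)).
apply: game_p_laplacian_leD => // y; rewrite (negbTE xO) addr0 lerD2r.
by case: ifPn => // yO; rewrite set_min_le.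
Qed.

End EulerStep.
End GameLaplacian.

Theorem theorem3p7 (R : realType) (X : finType) (w : X -> X -> R)
    (O : {set X}) (g : X -> R) (p : \bar R) (alpha : R) (ustar : X -> R)
    (w_sym : forall x y : X, w x y = w y x)
    (w_ge0 : forall x y : X, 0 <= w x y)
    (w_le1 : forall x y : X, w x y <= 1)
    (w_conn : wgraph_connected w)
    (deg_gt0 : forall x : X, 0 < wdegree w x)
    (O_neq0 : O != finset.set0)
    (p_ge2 : (2%:E <= p)%E)
    (alpha_gt0 : 0 < alpha)
    (alpha_le : alpha <= max_time_step p)
    (ustar_sol : is_solution w p O g ustar) :
  (forall k : nat, (1 <= k)%N -> forall x : X,
     `|mid_iter w p O g alpha k x - ustar x| <=
       2^-1 * `|upper_iter w p O g alpha k x - lower_iter w p O g alpha k x|) /\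
  (forall x : X,
     upper_iter w p O g alpha k x @[k --> \oo] --> ustar x /\
     lower_iter w p O g alpha k x @[k --> \oo] --> ustar x).
Proof.
have sol_unique u : is_solution w p O g u -> u = ustar.
  by move=> us; exact: solution_unique us ustar_sol.
have lo k x : lower_iter w p O g alpha k x <= ustar x by exact: lower_iter_le.
have up k x : ustar x <= upper_iter w p O g alpha k x by exact: upper_iter_ge.
split=> [k _ x|x].
  have := lo k x; have := up k x; rewrite /mid_iter => ux lx.
  rewrite [X in _ <= _ * X]ger0_norm ?subr_ge0 ?(le_trans lx)// ler_norml.
  (* Both bounds on the midpoint error rearrange to [lower <= ustar <= upper]. *)
  by apply/andP; lra.
split.
- have cvu y : cvgn (fun k => upper_iter w p O g alpha k y).
    apply: nonincreasing_is_cvgn; first exact: upper_iter_nonincreasing.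
    by exists (ustar y) => _ [k _ <-].
  (* The pointwise limit is a solution, hence [ustar]; after the rewriting each sequence has to
     converge to its own limit. *)
  rewrite -(sol_unique (fun y => limn (fun k => upper_iter w p O g alpha k y))).
    exact: cvu.
  by apply: (iter_euler_step_lim _ _ _ _ _ alpha_le) => // y; exact: cvu.
- have cvl y : cvgn (fun k => lower_iter w p O g alpha k y).
    apply: nondecreasing_is_cvgn; first exact: lower_iter_nondecreasing.
    by exists (ustar y) => _ [k _ <-].
  rewrite -(sol_unique (fun y => limn (fun k => lower_iter w p O g alpha k y))).
    exact: cvl.
  by apply: (iter_euler_step_lim _ _ _ _ _ alpha_le) => // y; exact: cvl.
Qed.
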